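(* Let $t\ge 2$ and let $H=(V,E)$ be a finite $t$-uniform hypergraph with maximum degree $D$. Let $P_H(x)$ be the polynomial such that for every positive integer $q$, $P_H(q)$ is the number of colorings of $V$ with $q$ colors such that no edge of $H$ has all of its vertices colored with the same color. Then every complex root $z$ of $P_H(x)$ satisfies $|z|\le 8etD$.
   Context: A hypergraph $H=(V,E)$ has a finite vertex set $V$ and a set $E$ of nonempty subsets of $V$ (edges); it is $t$-uniform if every edge has exactly $t$ vertices. The degree of a vertex is the number of edges containing it, and $D$ is the maximum degree over all vertices. By inclusion–exclusion, $P_H(x)=\sum_{E'\subseteq E}(-1)^{|E'|}x^{c(E')}$, where $c(E')$ is the number of connected components of the hypergraph $(V,E')$; in particular $P_H$ is indeed a polynomial. Here $e$ is Euler's number. *)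

(* Defs.v *)
From HB Require Import structures.
From mathcomp Require Import all_boot all_order all_algebra.

Set Implicit Arguments.
Unset Strict Implicit.
Unset Printing Implicit Defensive.

Import GRing.Theory.

Local Open Scope ring_scope.

Record hypergraph (V : finType) := Hypergraph {
  edges : {set {set V}};
  edges_nonempty : set0 \notin edges
}.

Section HypergraphDefs.

Variables (V : finType) (H : hypergraph V).

Definition uniform (t : nat) : bool := [forall e in edges H, #|e| == t].

Definition degree (v : V) : nat := #|[set e in edges H | v \in e]|.

Definition max_degree : nat := \max_(v : V) degree v.

Definition monochromatic (q : nat) (f : {ffun V -> 'I_q}) (e : {set V}) : bool :=
  [exists c : 'I_q, [forall v in e, f v == c]].

Definition proper_colorings (q : nat) : {set {ffun V -> 'I_q}} :=
  [set f : {ffun V -> 'I_q} | [forall e in edges H, ~~ monochromatic f e]].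

(* Over an integral domain of characteristic zero there is exactly one such P,
   namely sum_(F subset E) (-1)^#|F| 'X^c(F) with c(F) the number of connected
   components of (V, F). *)
Definition is_chromatic_poly (K : nzRingType) (P : {poly K}) : Prop :=
  forall q : nat, (0 < q)%N -> P.[q%:R] = #|proper_colorings q|%:R.

End HypergraphDefs.

(* Main.v *)
(** Let Y(S) be the value at z of the chromatic polynomial of the subhypergraph
  induced by S, all vertices outside S being kept as isolated vertices. If
  |z| >= 12 D, then |Y(S - v)| <= 2 |Y(S)| for every v in S, by induction on S;
  hence Y never vanishes.
  For the induction step, start from the cluster A = {v} and delete-contract the
  edges meeting A one at a time: contracting e costs z^-j with j = #|e - A|,
  enlarges A to A + e and brings at most j D new edges into contact with A.
  When no edge meets A any more, what is left is Y(S - A), which the induction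
  hypothesis bounds by 2^(#|A| - 1) |Y(S - v)|. With u = 3 / |z|, every
  edge in contact with A contributes at most a factor 1 + u, since
  (1 + u)^D <= 3/2 gives (2 (1 + u)^D / |z|)^j <= u. Altogether
  |Y(S) - Y(S - v)| <= ((1 + u)^D - 1) |Y(S - v)| <= |Y(S - v)| / 2. *)
Require Import Defs.
From mathcomp Require Import all_boot all_order all_algebra.
From mathcomp Require Import reals sequences exp.
From mathcomp Require Import complex.
From mathcomp Require Import ring.

Set Implicit Arguments.
Unset Strict Implicit.
Unset Printing Implicit Defensive.

Import Order.TTheory GRing.Theory Num.Theory.

Local Open Scope ring_scope.
Local Open Scope complex_scope.

(** A nonzero difference would have too many roots for its degree: 1, ..., [size (p1 - p2)],
    distinct in characteristic zero. *)
Lemma eq_poly_nat (K : numDomainType) (p1 p2 : {poly K}) :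
  (forall q : nat, (0 < q)%N -> p1.[q%:R] = p2.[q%:R]) -> p1 = p2.
Proof.
move=> eq_p; apply/eqP; rewrite -subr_eq0; apply/eqP.
pose s := [seq q%:R : K | q <- iota 1 (size (p1 - p2))].
apply: (@roots_geq_poly_eq0 _ _ s); last by rewrite size_map size_iota.
  apply/allP=> _ /mapP[q + ->]; rewrite mem_iota => /andP[q_gt0 _].
  by rewrite rootE !hornerE eq_p ?subrr.
by rewrite map_inj_uniq ?iota_uniq // => m n /eqP; rewrite eqr_nat => /eqP.
Qed.

(** * Counting colorings that are constant on prescribed sets *)

Section Colorings.

Variable V : finType.
Implicit Types (A e : {set V}) (E : {set {set V}}) (Fs Es : seq {set V}).

Lemma monochromaticP q (f : {ffun V -> 'I_q}) e : (0 < q)%N ->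
  reflect {in e &, forall x y, f x = f y} (monochromatic f e).
Proof.
move=> q_gt0; apply: (iffP existsP) => [[c /'forall_implyP f_c] x y|f_e].
  by move=> /f_c/eqP-> /f_c/eqP->.
have [->|[a ae]] := set_0Vmem e.
  by exists (Ordinal q_gt0); apply/'forall_implyP=> x; rewrite inE.
by exists (f a); apply/'forall_implyP=> x xe; apply/eqP/f_e.
Qed.

(** Its connectivity classes are the components of the hypergraph with edge set [Fs]; thus
    [n_comp (share Fs) V] is c(Fs). *)
Definition share Fs : rel V := fun x y => has (fun e => (x \in e) && (y \in e)) Fs.

Lemma share_sym Fs : connect_sym (share Fs).
Proof.
by apply: sym_connect_sym => x y; apply: eq_has => e; rewrite andbC.
Qed.

Lemma all_monochromaticP q (f : {ffun V -> 'I_q}) Fs : (0 < q)%N ->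
  reflect (forall x, f (fingraph.root (share Fs) x) = f x) (all (monochromatic f) Fs).
Proof.
move=> q_gt0; apply: (iffP allP) => [f_F x|f_root e eF].
  have /connectP[p] := connect_root (share Fs) x.
  move: (fingraph.root _ x) => y; elim: p x => [x _ -> //|z p IHp x /=].
  move=> /andP[/hasP[e eF /andP[xe ze]] pz lastp].
  by rewrite (IHp z) //; apply/esym/(monochromaticP f e q_gt0 (f_F e eF)).
apply/monochromaticP => // x y xe ye; rewrite -f_root -[RHS]f_root.
congr (f _); apply/eqP; rewrite root_connect; last exact: share_sym.
by apply: connect1; apply/hasP; exists e; rewrite ?xe.
Qed.

(** Such a coloring is constant on components, so it amounts to a free choice of colors at their
    roots. *)
Lemma card_all_monochromatic q Fs : (0 < q)%N ->
  #|[set f : {ffun V -> 'I_q} | all (monochromatic f) Fs]|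
    = (q ^ n_comp (share Fs) V)%N.
Proof.
move=> q_gt0; pose r := share Fs; pose T := {x | roots r x}.
have rootT x : roots r (fingraph.root r x) by apply: roots_root; exact: share_sym.
pose lift (g : {ffun T -> 'I_q}) : {ffun V -> 'I_q} :=
  [ffun x => g (Sub (fingraph.root r x) (rootT x))].
have lift_inj : injective lift.
  move=> g1 g2 /ffunP eq_g; apply/ffunP=> -[x xT]; have:= eq_g x.
  by rewrite !ffunE; congr (g1 _ = g2 _); apply: val_inj; rewrite /= (eqP xT).
have -> : [set f : {ffun V -> 'I_q} | all (monochromatic f) Fs]
          = [set lift g | g : {ffun T -> 'I_q}].
  apply/setP=> f; rewrite inE; apply/all_monochromaticP/imsetP => //.
    move=> f_root; exists [ffun t : T => f (val t)] => //.
    by apply/ffunP=> x; rewrite !ffunE /= f_root.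
  case=> g _ -> x; rewrite !ffunE; congr (g _); apply: val_inj => /=.
  by rewrite root_root //; exact: share_sym.
rewrite card_imset // card_ffun card_ord card_sig; congr (_ ^ _)%N.
by apply: eq_card => x; rewrite !inE andbT.
Qed.

(** Contraction of [A] without a quotient: the common color on [A] plays the color of the merged
    vertex, and [V] stays fixed. *)
Definition semiproper q A E : {set {ffun V -> 'I_q}} :=
  [set f : {ffun V -> 'I_q} |
    monochromatic f A && [forall e in E, ~~ monochromatic f e]].

Lemma card_semiproper0 q A E e : (0 < q)%N ->
  e \in E -> e \subset A -> #|semiproper q A E| = 0%N.
Proof.
move=> q_gt0 eE eA; apply/eqP; rewrite cards_eq0; apply/eqP/setP=> f.
rewrite !inE; apply/negP=> /andP[/monochromaticP fA /'forall_implyP/(_ e eE)].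
case/monochromaticP => // x y /(subsetP eA) xA /(subsetP eA) yA.
exact: fA.
Qed.

Lemma semiproper1 q v E : (0 < q)%N -> semiproper q [set v] E = semiproper q set0 E.
Proof.
move=> q_gt0; apply/setP=> f; rewrite !inE; congr (_ && _).
apply/monochromaticP/monochromaticP => // _ x y; last by rewrite !inE => /eqP-> /eqP->.
by rewrite inE.
Qed.

(** Split on whether [e] is monochromatic; as [A] meets [e], both are monochromatic exactly when
    their union is. *)
Lemma card_semiproper_delete q A E e : (0 < q)%N ->
  e \in E -> A :&: e != set0 ->
  #|semiproper q A (E :\ e)|
    = (#|semiproper q A E| + #|semiproper q (A :|: e) (E :\ e)|)%N.
Proof.
move=> q_gt0 eE /set0Pn[a]; rewrite inE => /andP[aA ae].
rewrite -(cardsID [set f | monochromatic f e]) addnC; congr (_ + _)%N;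
  apply: eq_card => f; rewrite !inE; last first.
  rewrite andbAC; congr (_ && _); apply/andP/idP.
    case=> /(monochromaticP _ _ q_gt0) fA /(monochromaticP _ _ q_gt0) fe.
    have fa x : x \in A :|: e -> f x = f a by case/setUP=> ?; [apply: fA | apply: fe].
    by apply/monochromaticP => // x y /fa-> /fa->.
  move/(monochromaticP _ _ q_gt0) => fAe.
  by split; apply/monochromaticP => // x y xA yA; apply: fAe; rewrite inE ?xA ?yA ?orbT.
rewrite andbCA; congr (_ && _); apply/andP/'forall_implyP.
  case=> fe /'forall_implyP fE e' e'E; have [->//|ne] := eqVneq e' e.
  by apply: fE; rewrite !inE ne.
move=> fE; split; first exact: fE.
by apply/'forall_implyP=> e' /setD1P[_ /fE].
Qed.

(** Nothing constrains [v]: recoloring it in all [q] ways in the colorings where it agrees with [A]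
    gives each coloring once. The color of [a] tells how to undo this. *)
Lemma card_semiproper_free q A E a v : (0 < q)%N ->
  a \in A -> v \notin A -> {in E, forall e, v \notin e} ->
  #|semiproper q A E| = (q * #|semiproper q (v |: A) E|)%N.
Proof.
move=> q_gt0 aA vA vE; have av : a != v by apply: contraNneq vA => <-.
pose upd (f : {ffun V -> 'I_q}) c := [ffun x => if x == v then c else f x].
have mono_upd f c e : v \notin e -> monochromatic (upd f c) e = monochromatic f e.
  move=> ve; apply: eq_existsb => c'; apply: eq_forallb_in => x xe.
  by rewrite ffunE ifN //; apply: contraNneq ve => <-.
have updE f c : [forall e in E, ~~ monochromatic (upd f c) e]
                = [forall e in E, ~~ monochromatic f e].
  by apply: eq_forallb_in => e eE; rewrite mono_upd ?vE.
pose h (p : {ffun V -> 'I_q} * 'I_q) := upd p.1 p.2.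
have -> : (q * #|semiproper q (v |: A) E|)%N
          = #|setX (semiproper q (v |: A) E) [set: 'I_q]|.
  by rewrite cardsX cardsT card_ord mulnC.
rewrite -(@card_in_imset _ _ h) => [|[f c] [g d]]; last first.
  rewrite !inE !andbT /= => /andP[/(monochromaticP _ _ q_gt0) fA _].
  case/andP=> /(monochromaticP _ _ q_gt0) gA _ /ffunP eq_h.
  have eq_fg x : x != v -> f x = g x by move/negPf=> xv; have:= eq_h x; rewrite !ffunE xv.
  congr (_, _); last by have:= eq_h v; rewrite !ffunE eqxx.
  apply/ffunP=> x; have [->|/eq_fg//] := eqVneq x v.
  have [va aA'] : v \in v |: A /\ a \in v |: A by rewrite !inE eqxx aA orbT.
  by rewrite (fA v a) // (gA v a) // eq_fg.
apply: eq_card => f; apply/idP/imsetP => [|[[g c]]]; rewrite !inE.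
  case/andP=> /(monochromaticP _ _ q_gt0) fA fE; exists (upd f (f a), f v).
    rewrite !inE updE fE !andbT /=; apply/monochromaticP => //.
    have fa x : x \in v |: A -> upd f (f a) x = f a.
      by rewrite !inE ffunE; case: eqP => //= _ xA; apply: fA.
    by move=> x y /fa-> /fa->.
  by apply/ffunP=> x; rewrite !ffunE; case: eqP => // ->.
rewrite andbT /= => /andP[/(monochromaticP _ _ q_gt0) gA gE] ->.
rewrite [h _]/(upd g c) mono_upd // updE gE andbT.
by apply/monochromaticP => // x y xA yA; apply: gA; rewrite inE ?xA ?yA orbT.
Qed.

(** * Counting polynomials and their deletion-contraction rules *)

Variable K : numFieldType.

(** Inclusion-exclusion one edge at a time; [Fs] collects the sets forced to be monochromatic. *)
Fixpoint mixed_poly Fs Es : {poly K} :=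
  if Es is e :: Es' then mixed_poly Fs Es' - mixed_poly (e :: Fs) Es'
  else 'X^(n_comp (share Fs) V).

Lemma horner_mixed_poly q Fs Es : (0 < q)%N ->
  (mixed_poly Fs Es).[q%:R] =
  #|[set f : {ffun V -> 'I_q} | all (monochromatic f) Fs &&
                               all (fun e => ~~ monochromatic f e) Es]|%:R.
Proof.
move=> q_gt0; elim: Es Fs => [|e Es IHE] Fs /=.
  rewrite hornerXn -natrX -card_all_monochromatic //.
  by congr _%:R; apply: eq_card => f; rewrite !inE andbT.
rewrite hornerD hornerN !IHE /=; apply/eqP; rewrite subr_eq -natrD eqr_nat; apply/eqP.
rewrite -(cardsID [set f | monochromatic f e]) addnC.
by congr (_ + _)%N; apply: eq_card => f; rewrite !inE;
  case: (monochromatic f e); rewrite ?andbF ?andbT.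
Qed.

Definition semi_poly A E : {poly K} := mixed_poly [:: A] (enum E).

Lemma horner_semi_poly q A E : (0 < q)%N ->
  (semi_poly A E).[q%:R] = #|semiproper q A E|%:R.
Proof.
move=> q_gt0; rewrite horner_mixed_poly //; congr _%:R.
apply: eq_card => f; rewrite !inE /= andbT; congr (_ && _).
apply/allP/'forall_implyP => fE e eE; apply: fE; rewrite ?mem_enum //.
by rewrite -mem_enum.
Qed.

Lemma semi_poly_eq0 A E e : e \in E -> e \subset A -> semi_poly A E = 0.
Proof.
move=> eE eA; apply: eq_poly_nat => q q_gt0.
by rewrite horner_semi_poly // (card_semiproper0 q_gt0 eE) ?horner0.
Qed.

Lemma semi_poly1 v E : semi_poly [set v] E = semi_poly set0 E.
Proof.
by apply: eq_poly_nat => q q_gt0; rewrite !horner_semi_poly ?semiproper1.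
Qed.

Lemma semi_poly_delete A E e : e \in E -> A :&: e != set0 ->
  semi_poly A E = semi_poly A (E :\ e) - semi_poly (A :|: e) (E :\ e).
Proof.
move=> eE Ae; apply: eq_poly_nat => q q_gt0.
rewrite hornerD hornerN !horner_semi_poly // (card_semiproper_delete q_gt0 eE) //.
by rewrite natrD addrK.
Qed.

(** The vertices of [A] lie in no edge: releasing all but one of them gives a factor ['X] each, and
    a cluster of one vertex is no constraint. *)
Lemma semi_poly_disjoint A E : A != set0 -> {in E, forall e, [disjoint A & e]} ->
  'X^(#|A|.-1) * semi_poly A E = semi_poly set0 E.
Proof.
have [n] := ubnP #|A|; elim: n A => // n IHn A leAn /set0Pn[a aA] disE.
have [A1|[v]] := set_0Vmem (A :\ a).
  by rewrite -(setD1K aA) A1 setU0 cards1 mul1r semi_poly1.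
rewrite !inE => /andP[va vA]; have av : a \in A :\ v by rewrite !inE eq_sym va.
have card_A := cardsD1 v A; rewrite vA add1n in card_A.
rewrite -(IHn (A :\ v)); first last.
- move=> e /disE; apply: disjointWl; exact: subD1set.
- by apply/set0Pn; exists a.
- by rewrite -ltnS -card_A.
have -> : semi_poly (A :\ v) E = 'X * semi_poly A E.
  apply: eq_poly_nat => q q_gt0; rewrite hornerM hornerX !horner_semi_poly // -natrM.
  congr _%:R; rewrite -[in RHS](setD1K vA).
  apply: (card_semiproper_free q_gt0 av); first by rewrite !inE eqxx.
  by move=> e /disE/disjointFr->.
rewrite mulrA -exprSr card_A /= prednK //.
by apply/card_gt0P; exists a.
Qed.

Lemma chromatic_polyE (H : hypergraph V) (P : {poly K}) :
  is_chromatic_poly H P -> P = semi_poly set0 (edges H).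
Proof.
move=> HP; apply: eq_poly_nat => q q_gt0; rewrite HP // horner_semi_poly //.
congr _%:R; apply: eq_card => f; rewrite !inE.
by case: monochromaticP => // -[] x y; rewrite inE.
Qed.

End Colorings.

(** A reverse Bernoulli inequality: in the induction the cross term [2 * (n%:R * a) * a] is at most
    [a]. *)
Lemma expr1D_le (K : numFieldType) (a : K) n : 0 <= a -> n%:R * a <= 2^-1 ->
  (1 + a) ^+ n <= 1 + 2 * (n%:R * a).
Proof.
move=> a_ge0; elim: n => [|n IHn] le_na; first by rewrite mul0r mulr0 addr0.
have na : n%:R * a <= 2^-1.
  by apply: le_trans le_na; rewrite ler_wpM2r // ler_nat.
have na2 : 2 * (n%:R * a) <= 1 by rewrite -ler_pdivlMl // mulr1.
rewrite exprSr; apply: le_trans (ler_wpM2r _ (IHn na)) _; first exact: addr_ge0.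
have -> : n.+1%:R * a = n%:R * a + a by rewrite -[n.+1]addn1 natrD mulrDl mul1r.
rewrite !mulrDr mulr1 -addrA !lerD2l mulrDl mul1r [2 * a]mulr_natl mulr2n lerD2l.
exact: ler_piMl.
Qed.

(** * Clusters and their estimates for |z| >= 12 D *)

Section ZeroFreeDisk.

Variables (V : finType) (K : numFieldType) (E0 : {set {set V}}) (D : nat) (z : K).
Implicit Types (A B C S e : {set V}) (E : {set {set V}}).

Hypothesis card_edge : forall e, e \in E0 -> (1 < #|e|)%N.
Hypothesis leq_degree : forall v, (#|[set e in E0 | v \in e]| <= D)%N.
Hypothesis z_neq0 : z != 0.
Hypothesis z_large : 12 * D%:R <= `|z|.

(** The 3 is 2 times 3/2: a factor 2 per removed vertex and the bound 3/2 on [(1 + u) ^+ D]. *)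
Let u := 3 / `|z|.

Let z_gt0 : 0 < `|z|. Proof. by rewrite normr_gt0. Qed.

Let u_ge0 : 0 <= u. Proof. by rewrite divr_ge0. Qed.

Let u1_ge0 : 0 <= 1 + u. Proof. by rewrite addr_ge0. Qed.

Let u1_ge1 : 1 <= 1 + u. Proof. by rewrite lerDl. Qed.

Lemma exprD_le32 n : (n <= D)%N -> (1 + u) ^+ n <= 3 / 2.
Proof.
move=> le_nD.
(* This is where 12 = 3 * 4 enters: n u <= 3 D / |z| <= 1/4. *)
have nu : n%:R * u <= 4^-1.
  rewrite /u mulrA ler_pdivrMr // -ler_pdivrMl ?invr_gt0 // invrK.
  rewrite mulrCA -natrM mulrC; apply: le_trans z_large.
  by rewrite -!natrM ler_nat leq_mul2l.
apply: le_trans (expr1D_le u_ge0 _) _.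
  by apply: le_trans nu _; rewrite lef_pV2 ?posrE // ler_nat.
have -> : 3 / 2 = 1 + 2 * 4^-1 :> K by field.
by rewrite lerD2l ler_pM2l.
Qed.

(** Total cost of contracting an edge with [j] new vertices. It is the [j]-th power of a base that
    is at most u <= 1, so it stays below u. *)
Lemma merge_le_u j : (0 < j)%N -> (0 < D)%N ->
  `|z| ^- j * ((1 + u) ^+ (j * D) * 2 ^+ j) <= u.
Proof.
move=> j_gt0 D_gt0; rewrite mulnC exprM -exprMn -exprVn -exprMn.
have le_u : `|z|^-1 * ((1 + u) ^+ D * 2) <= u.
  rewrite mulrC ler_pM2r ?invr_gt0 // -ler_pdivlMr //.
  exact: exprD_le32.
have ge0 : 0 <= `|z|^-1 * ((1 + u) ^+ D * 2).
  by rewrite mulr_ge0 ?invr_ge0 ?mulr_ge0 ?exprn_ge0.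
apply: le_trans (ler_iXnr _ ge0 (le_trans le_u _)) le_u => //.
(* Since [0 < D], |z| >= 12 and hence u <= 1. *)
rewrite /u ler_pdivrMr // mul1r; apply: le_trans z_large.
by rewrite -natrM ler_nat (@leq_trans 12) // leq_pmulr.
Qed.

Definition induced S : {set {set V}} := [set e in E0 | e \subset S].

Definition touching A E : {set {set V}} := [set e in E | A :&: e != set0].

Definition chrom S : K := (semi_poly K set0 (induced S)).[z].

(* With n = #|V| and H' the hypergraph obtained by contracting A to one vertex,
   this is z^n times P_(H')(z) / z^(n - #|A| + 1): normalizing by the number of
   vertices makes it comparable with [chrom]. *)
Definition merged A E : K := z ^+ #|A|.-1 * (semi_poly K A E).[z].

(** The cluster absorbs [#|e :\: A|] vertices, which raises the normalizing exponent by that much;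
    the negative power compensates. *)
Lemma merged_delete A E e : e \in E -> A :&: e != set0 ->
  merged A E = merged A (E :\ e) - z ^- #|e :\: A| * merged (A :|: e) (E :\ e).
Proof.
move=> eE Ae; rewrite /merged (semi_poly_delete K eE Ae) hornerD hornerN mulrBr.
congr (_ - _); rewrite mulrA; congr (_ * _).
have -> : #|A :|: e|.-1 = (#|e :\: A| + #|A|.-1)%N.
  rewrite -(cardsID A) setUK setDUl setDv set0U addnC.
  rewrite -[in LHS](@prednK #|A|) ?addnS //.
  by have /set0Pn[a /setIP[aA _]] := Ae; apply/card_gt0P; exists a.
by rewrite exprD mulKf // expf_neq0.
Qed.

Lemma merged_disjoint A E : A != set0 -> touching A E = set0 ->
  merged A E = (semi_poly K set0 E).[z].
Proof.
move=> A0 tE; rewrite -(semi_poly_disjoint K A0) ?hornerM ?hornerXn // => e eE.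
have /setP/(_ e) := tE; rewrite !inE eE -setI_eq0 /= => /negbFE.
by [].
Qed.

(** Add the vertices of [e :\: A] one at a time: an edge that starts touching contains the added
    vertex. *)
Lemma card_touchingU A e E : E \subset E0 ->
  (#|touching (A :|: e) E| <= #|touching A E| + #|e :\: A| * D)%N.
Proof.
move=> sE; have [n] := ubnP #|e :\: A|; elim: n A => // n IHn A lt_n.
have [eA|[v]] := set_0Vmem (e :\: A).
  by move/eqP: eA; rewrite setD_eq0 => eA; rewrite (setUidPl eA) leq_addr.
move=> vB; have /setDP[ve vA] := vB.
have eDA : e :\: (v |: A) = (e :\: A) :\ v by rewrite setUC -setDDl.
have cB := cardsD1 v (e :\: A); rewrite vB add1n in cB.
have -> : A :|: e = (v |: A) :|: e by rewrite [v |: A]setUC -setUA [v |: e](setUidPr _) ?sub1set.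
apply: leq_trans (IHn _ _) _; first by rewrite eDA -ltnS -cB.
rewrite eDA cB mulSn addnA leq_add2r.
apply: leq_trans (leq_add (leqnn _) (leq_degree v)).
apply: leq_trans (leq_card_setU _ _); apply: subset_leq_card.
apply/subsetP=> e'; rewrite !inE => /andP[e'E /set0Pn[w]].
rewrite !inE e'E (subsetP sE) //= => /andP[/predU1P[->->|wA we']].
  by rewrite orbT.
by apply/orP; left; apply/set0Pn; exists w; rewrite inE wA.
Qed.

(** Remove [C] vertex by vertex; all intermediate sets remain proper subsets of [S], where the
    hypothesis applies. *)
Lemma chromD_le S B C : B \proper S -> C \subset B ->
  (forall B' v, B' \proper S -> v \in B' -> `|chrom (B' :\ v)| <= 2 * `|chrom B'|) ->
  `|chrom (B :\: C)| <= 2 ^+ #|C| * `|chrom B|.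
Proof.
move=> pB sC HS; have [n] := ubnP #|C|; elim: n B C pB sC => // n IHn B C pB sC lt_n.
have [->|[v vC]] := set_0Vmem C; first by rewrite setD0 cards0 mul1r.
have vB := subsetP sC v vC.
have cC := cardsD1 v C; rewrite vC add1n in cC.
have -> : B :\: C = (B :\ v) :\: (C :\ v) by rewrite setDDl setD1K.
apply: le_trans (IHn _ _ _ _ _) _.
- exact: sub_proper_trans (subD1set _ _) pB.
- exact: setSD.
- by rewrite -ltnS -cC.
rewrite cC exprSr -mulrA ler_pM2l ?exprn_gt0 //; exact: HS.
Qed.

(** * The induction step on [S] *)

Section Step.

Variable S : {set V}.
Hypothesis chromD1_le : forall B v, B \proper S -> v \in B ->
  `|chrom (B :\ v)| <= 2 * `|chrom B|.

(** Induction on [#|E|]. The two inclusions say that only edges meeting [A] have been discarded, so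
    [E] is [induced (S :\: A)] once nothing touches [A]. *)
Lemma merged_near A E : A != set0 -> A \subset S ->
  induced (S :\: A) \subset E -> E \subset induced S ->
  {in E, forall e, ~~ (e \subset A)} ->
  `|merged A E - chrom (S :\: A)|
    <= ((1 + u) ^+ #|touching A E| - 1) * `|chrom (S :\: A)|.
Proof.
have [n] := ubnP #|E|; elim: n A E => // n IHn A E lt_n A0 sA iE sE nE.
have [tE|[e]] := set_0Vmem (touching A E).
  rewrite merged_disjoint // tE cards0 expr0 subrr mul0r.
  suff -> : E = induced (S :\: A) by rewrite subrr normr0.
  apply/eqP; rewrite eqEsubset iE andbT; apply/subsetP=> e eE.
  have:= subsetP sE e eE; rewrite !inE => /andP[-> eS].
  rewrite subsetD eS /= disjoint_sym -setI_eq0.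
  by have /setP/(_ e) := tE; rewrite !inE eE => /negbFE.
rewrite inE => /andP[eE Ae]; have := subsetP sE e eE; rewrite inE => /andP[eE0 eS].
have cE := cardsD1 e E; rewrite eE add1n in cE.
have lt_nE : (#|E :\ e| < n)%N by rewrite -ltnS -cE.
have sE0 : E :\ e \subset E0.
  by apply/subsetP=> e' /setD1P[_ /(subsetP sE)]; rewrite inE => /andP[].
have sEe : E :\ e \subset induced S by apply: subset_trans sE; apply: subD1set.
set Y := `|chrom (S :\: A)|; set j := #|e :\: A|.
have Y_ge0 : 0 <= Y by exact: normr_ge0.
set d := #|touching A (E :\ e)|.
have -> : #|touching A E| = d.+1.
  rewrite (cardsD1 e) inE eE Ae add1n; congr _.+1.
  by apply: eq_card => e'; rewrite !inE andbA.
have j_gt0 : (0 < j)%N.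
  by rewrite card_gt0 setD_eq0 nE.
have D_gt0 : (0 < D)%N.
  have /set0Pn[a /setIP[_ ae]] := Ae; apply: leq_trans (leq_degree a).
  by apply/card_gt0P; exists e; rewrite inE eE0.
have near1 : `|merged A (E :\ e) - chrom (S :\: A)| <= ((1 + u) ^+ d - 1) * Y.
  apply: IHn => // [|e' /setD1P[_ /nE]//].
  apply/subsetP=> e' e'i; rewrite !inE (subsetP iE) // andbT.
  apply: contraNneq Ae => <-; move: e'i; rewrite inE subsetD => /andP[_ /andP[_]].
  by rewrite disjoint_sym -setI_eq0.
have near2 : `|merged (A :|: e) (E :\ e)| <= (1 + u) ^+ (d + j * D) * (2 ^+ j * Y).
  (* An edge inside A :|: e makes the contracted hypergraph uncolorable. *)
  have [[e' e'E e'A]|no_e] :=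
    altP (@exists_inP _ (mem (E :\ e)) (fun e' => e' \subset A :|: e)).
    rewrite /merged (semi_poly_eq0 K e'E e'A) horner0 mulr0 normr0.
    by rewrite !mulr_ge0 ?exprn_ge0.
  have {}no_e : {in E :\ e, forall e', ~~ (e' \subset A :|: e)}.
    by move=> e' e'E; apply: contraNN no_e => e'A; apply/exists_inP; exists e'.
  have le_Y : `|chrom (S :\: (A :|: e))| <= 2 ^+ j * Y.
    have -> : S :\: (A :|: e) = (S :\: A) :\: (e :\: A).
      by apply/setP=> x; rewrite !inE; case: (x \in A); rewrite ?andbF.
    apply: (chromD_le (S := S)) => //; last exact: setSD.
    rewrite properE subsetDl; have /set0Pn[a aA] := A0.
    by apply/subsetPn; exists a; [exact: (subsetP sA) | rewrite inE aA].
  have U0 : A :|: e != set0 by rewrite setU_eq0 negb_and A0.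
  (* The induction hypothesis bounds a distance; the triangle inequality cancels its [- 1]. *)
  have le1 : `|merged (A :|: e) (E :\ e)|
     <= (1 + u) ^+ #|touching (A :|: e) (E :\ e)| * `|chrom (S :\: (A :|: e))|.
    rewrite -[merged _ _](subrK (chrom (S :\: (A :|: e)))).
    apply: le_trans (ler_normD _ _) _.
    rewrite -lerBrDr -{2}[`|chrom _|]mul1r -mulrBl; apply: IHn => //.
      by rewrite subUset sA.
    apply/subsetP=> e' e'i; rewrite !inE; apply/andP; split.
      apply: contraNneq Ae => ee'; move: e'i; rewrite ee' inE subsetD.
      move=> /and3P[_ _ /disjoint_setI0]; rewrite setIUr setIid => /eqP.
      by rewrite setU_eq0 setIC => /andP[].
    apply: (subsetP iE); move: e'i; rewrite !inE => /andP[->] /= /subset_trans; apply.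
    by apply: setDS; apply: subsetUl.
  apply: le_trans le1 _; apply: ler_pM => //; first exact: exprn_ge0.
  by apply: ler_weXn2l => //; apply: card_touchingU.
rewrite (merged_delete eE Ae) addrAC; apply: le_trans (ler_normB _ _) _.
(* The increment [(1 + u) ^+ d * u * Y] pays for the contracted term. *)
have -> : ((1 + u) ^+ d.+1 - 1) * Y = ((1 + u) ^+ d - 1) * Y + (1 + u) ^+ d * u * Y.
  by rewrite -mulrDl addrAC exprSr mulrDr mulr1.
apply: lerD near1 _; rewrite normrM normrV ?unitfE ?expf_neq0 // normrX.
apply: le_trans (ler_wpM2l _ near2) _; first by rewrite invr_ge0 exprn_ge0.
rewrite exprD 2!mulrA ![in leLHS]mulrA ler_wpM2r // -!mulrA mulrCA.
rewrite ler_wpM2l ?exprn_ge0 //.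
exact: merge_le_u.
Qed.

(** For the cluster [[set v]], [merged] is [chrom S] itself and at most [D] edges touch, so the
    relative error is at most 1/2. *)
Lemma chromD1_le_step v : v \in S -> `|chrom (S :\ v)| <= 2 * `|chrom S|.
Proof.
move=> vS; have iv : [set v] != set0 by apply/set0Pn; exists v; rewrite inE.
have near : `|merged [set v] (induced S) - chrom (S :\ v)|
    <= ((1 + u) ^+ #|touching [set v] (induced S)| - 1) * `|chrom (S :\ v)|.
  apply: merged_near => //; first by rewrite sub1set.
    apply/subsetP=> e; rewrite !inE => /andP[->] /=.
    by move=> /subset_trans; apply; apply: subsetDl.
  move=> e; rewrite inE => /andP[/card_edge e_gt1 _].
  by apply/negP=> /subset_leq_card; rewrite cards1 leqNgt e_gt1.
rewrite /merged cards1 mul1r semi_poly1 -/(chrom S) in near.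
have {near} : `|chrom S - chrom (S :\ v)| <= 2^-1 * `|chrom (S :\ v)|.
  apply: le_trans near _; apply: ler_wpM2r => //.
  rewrite lerBlDr; apply: le_trans (exprD_le32 _) _; last first.
    by rewrite [3](natrD _ 1 2) mulrDl mul1r divff ?pnatr_eq0.
  apply: leq_trans (leq_degree v); apply: subset_leq_card.
  apply/subsetP=> e; rewrite !inE => /andP[/andP[-> _]] /set0Pn[w].
  by rewrite !inE => /andP[/eqP->].
rewrite distrC => near; rewrite -ler_pdivrMl //.
(* By the reverse triangle inequality, half of [chrom (S :\ v)] survives in [chrom S]. *)
have := le_trans (lerB_dist _ _) near; rewrite lerBlDr -lerBlDl.
rewrite -{1}[`|_|]mul1r -mulrBl.
suff -> : 1 - 2^-1 = 2^-1 :> K by [].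
by field.
Qed.

End Step.

Lemma chromD1_le S v : v \in S -> `|chrom (S :\ v)| <= 2 * `|chrom S|.
Proof.
have [n] := ubnP #|S|; elim: n S v => // n IHn S v lt_n; apply: chromD1_le_step.
by move=> B w /proper_card lt_BS; apply: IHn; apply: leq_trans lt_BS _.
Qed.

(** A zero at [S] would pass to [S :\ v] and so down to [set0], where the value is a power of
    [z]. *)
Lemma chrom_neq0 S : chrom S != 0.
Proof.
have [n] := ubnP #|S|; elim: n S => // n IHn S lt_n.
have [->|[v vS]] := set_0Vmem S.
  have -> : chrom set0 = (semi_poly K (@set0 V) set0).[z].
    rewrite /chrom; congr (semi_poly K _ _).[z]; apply/setP=> e; rewrite !inE.
    apply/negP=> /andP[/card_edge + e0]; move: e0.
    by rewrite subset0 => /eqP->; rewrite cards0.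
  by rewrite /semi_poly enum_set0 hornerXn expf_neq0.
have cS := cardsD1 v S; rewrite vS add1n in cS.
have := IHn (S :\ v); rewrite -ltnS -cS => /(_ lt_n).
apply: contraNneq => S0; rewrite -normr_le0.
by apply: le_trans (chromD1_le vS) _; rewrite S0 normr0 mulr0.
Qed.

End ZeroFreeDisk.

(** * The root bound *)

Lemma chromatic_root_bound (K : numFieldType) (V : finType) (H : hypergraph V)
    (P : {poly K}) (z : K) :
  {in edges H, forall e : {set V}, (1 < #|e|)%N} -> is_chromatic_poly H P -> root P z ->
  z != 0 -> ~~ (12 * (max_degree H)%:R <= `|z|).
Proof.
move=> cE HP + z0; apply: contraTN => zD; rewrite (chromatic_polyE HP).
have := @chrom_neq0 V K (edges H) (max_degree H) z cE _ z0 zD setT.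
rewrite /chrom rootE (_ : induced _ _ = edges H); last first.
  by apply/setP=> e; rewrite !inE subsetT andbT.
by apply=> v; apply: (leq_bigmax v).
Qed.

Theorem theorem1 (R : realType) (t : nat) (ht : (2 <= t)%N)
    (V : finType) (H : hypergraph V) (hH : uniform H t)
    (D : nat) (hD : max_degree H = D)
    (P : {poly R[i]}) (hP : is_chromatic_poly H P)
    (z : R[i]) (hz : root P z) :
  `|z| <= (8 * expR 1 * t%:R * D%:R)%:C.
Proof.
have b_ge0 : 0 <= 8 * expR 1 * t%:R * D%:R :> R by rewrite !mulr_ge0 ?expR_ge0.
(* The estimates divide by [z]. *)
have [->|z0] := eqVneq z 0; first by rewrite normr0 ler0c.
have cE : {in edges H, forall e : {set V}, (1 < #|e|)%N}.
  by move=> e eE; have /'forall_implyP/(_ e eE)/eqP-> := hH.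
have := chromatic_root_bound cE hP hz z0; rewrite hD.
(* The order on [R[i]] is partial, but both sides are real, so the negation becomes a strict
   inequality. *)
rewrite -real_ltNge ?ger0_real ?normr_ge0 ?mulr_ge0 // => /ltW/le_trans; apply.
have -> : 12 * D%:R = (12 * D%:R)%:C :> R[i] by rewrite rmorphM !rmorph_nat.
rewrite lecR ler_wpM2r //.
(* With e >= 2 and t >= 2, 8 e t >= 32 >= 12. *)
have e2 : 2 <= expR 1 :> R by have := expR_ge1Dx (1 : R).
have t2 : 2 <= t%:R :> R by rewrite ler_nat.
apply: (@le_trans _ _ (8 * 2 * 2)); first by rewrite -!natrM ler_nat.
by rewrite ler_pM ?mulr_ge0 // ler_wpM2l.
Qed.
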